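(* Let $X$ be the Cantor set and let $G\leq \mathrm{Homeo}(X)$ be a piecewise full group, equipped with the compact-open topology. Then the following are equivalent: (i) $G$ is locally compact; (ii) $G$ is uniformly discrete; (iii) $G$ is discrete.
   Context: $X$ denotes the Cantor set and $\mathrm{Homeo}(X)$ its group of self-homeomorphisms, with the compact-open topology; a subgroup $G$ carries the subspace topology. A base of identity neighbourhoods in $\mathrm{Homeo}(X)$ is given by the subgroups $\{g : g(C)=C \text{ for all } C\in\mathcal{F}\}$, where $\mathcal{F}$ ranges over the finite sets of clopen subsets of $X$. For $G\le \mathrm{Homeo}(X)$, the piecewise full group $\mathbf{F}(G)$ consists of all $g\in \mathrm{Homeo}(X)$ for which there are a finite clopen partition $X=U_1\sqcup\dots\sqcup U_n$ and $g_1,\dots,g_n\in G$ with $g|_{U_i}=g_i|_{U_i}$ for all $i$. The group $G$ is piecewise full if $\mathbf{F}(G)=G$. $G\le \mathrm{Homeo}(X)$ is uniformly discrete if there exists a (finite) clopen partition $\mathcal{P}$ of $X$ such that $|Gx\cap U|\le 1$ for every $x\in X$ and every $U\in\mathcal{P}$, where $Gx$ is the $G$-orbit of $x$. *)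

(* Defs.v *)
From HB Require Import structures.
From mathcomp Require Import all_boot all_order all_algebra.
From mathcomp Require Import all_classical all_reals all_analysis.

Set Implicit Arguments.
Unset Strict Implicit.
Unset Printing Implicit Defensive.

Local Open Scope classical_set_scope.

Definition homeomorphism (X Y : topologicalType) (f : X -> Y) : Prop :=
  exists g : Y -> X,
    [/\ cancel f g, cancel g f, continuous f & continuous g].

(* The subtype of {compact-open, X -> X} carries the subspace topology. *)
Definition homeo (X : topologicalType) : Type :=
  set_type [set f : {compact-open, X -> X} | @homeomorphism X X f].

HB.instance Definition _ (X : topologicalType) := Topological.on (homeo X).

Section HomeoGroup.
Context {X : topologicalType}.
Implicit Types f g h : homeo X.

Definition homeo_fun f : X -> X := set_val f.

Definition mk_homeo (f : X -> X) (hf : homeomorphism f) : homeo X :=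
  exist _ (f : {compact-open, X -> X}) (mem_set hf).

Lemma homeo_funP f : homeomorphism (homeo_fun f).
Proof. by case: f => f hf; exact: set_mem hf. Qed.

Lemma homeo_eqP f g : homeo_fun f =1 homeo_fun g -> f = g.
Proof. by move=> fg; apply: val_inj; apply/funext. Qed.

Lemma homeomorphism_id : homeomorphism (@id X).
Proof. by exists id; split=> // x; exact: cvg_id. Qed.

Lemma homeomorphism_comp (f g : X -> X) :
  homeomorphism f -> homeomorphism g -> homeomorphism (f \o g).
Proof.
move=> [f' [fK f'K cf cf']] [g' [gK g'K cg cg']]; exists (g' \o f'); split.
- exact: can_comp.
- exact: can_comp.
- by move=> x; apply: continuous_comp; [exact: cg | exact: cf].
- by move=> x; apply: continuous_comp; [exact: cf' | exact: cg'].
Qed.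

Lemma homeomorphism_inv f : exists g : homeo X,
  cancel (homeo_fun f) (homeo_fun g) /\ cancel (homeo_fun g) (homeo_fun f).
Proof.
have [f' [fK f'K cf cf']] := homeo_funP f.
have hf' : homeomorphism f' by exists (homeo_fun f).
by exists (mk_homeo hf').
Qed.

Definition homeo_one : homeo X := mk_homeo homeomorphism_id.
Definition homeo_mul f g : homeo X :=
  mk_homeo (homeomorphism_comp (homeo_funP f) (homeo_funP g)).
Definition homeo_inv f : homeo X := projT1 (cid (homeomorphism_inv f)).

Lemma homeo_mulA : associative homeo_mul.
Proof. by move=> f g h; apply: homeo_eqP. Qed.
Lemma homeo_mul1 : left_id homeo_one homeo_mul.
Proof. by move=> f; apply: homeo_eqP. Qed.
Lemma homeo_mulr1 : right_id homeo_one homeo_mul.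
Proof. by move=> f; apply: homeo_eqP. Qed.
Lemma homeo_mulV : left_inverse homeo_one homeo_inv homeo_mul.
Proof.
move=> f; apply: homeo_eqP => x; rewrite /homeo_inv.
by case: cid => g [fK gK]; exact: fK.
Qed.
Lemma homeo_mulrV : right_inverse homeo_one homeo_inv homeo_mul.
Proof.
move=> f; apply: homeo_eqP => x; rewrite /homeo_inv.
by case: cid => g [fK gK]; exact: gK.
Qed.

End HomeoGroup.

Coercion homeo_fun : homeo >-> Funclass.

HB.instance Definition _ (X : topologicalType) :=
  isGroup.Build (homeo X) homeo_mulA homeo_mul1 homeo_mulr1
    homeo_mulV homeo_mulrV.

Section PiecewiseFull.
Context {X : topologicalType}.

Definition is_subgroup (G : set (homeo X)) : Prop := group_closed (mem G).

Definition clopen_partition (n : nat) (U : 'I_n -> set X) : Prop :=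
  partition [set: 'I_n] U [set: X] /\ forall i, clopen (U i).

Definition piecewise_full_group (G : set (homeo X)) : set (homeo X) :=
  [set g | exists (n : nat) (U : 'I_n -> set X) (h : 'I_n -> homeo X),
    [/\ clopen_partition U, forall i, G (h i)
      & forall i x, U i x -> g x = h i x]].

Definition piecewise_full (G : set (homeo X)) : Prop :=
  piecewise_full_group G = G.

Definition homeo_orbit (G : set (homeo X)) (x : X) : set X :=
  [set g x | g in G].

Definition uniformly_discrete (G : set (homeo X)) : Prop :=
  exists (n : nat) (U : 'I_n -> set X), clopen_partition U /\
    forall x i, is_subset1 (homeo_orbit G x `&` U i).

End PiecewiseFull.

(* The property bundled by the structure discreteTopologicalType. *)
Definition discrete_space (T : topologicalType) : Prop :=
  @nbhs T T = principal_filter.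

(* Main.v *)
(* Suppose G is locally compact. A compact neighbourhood of the identity contains
   every g in G that preserves all cylinders of some depth n. If an orbit met
   such a cylinder in two points a and g a, then for every small clopen
   neighbourhood V of a the involution exchanging V and g V pointwise along g
   lies in G, because G is piecewise full, and in the compact neighbourhood. Let
   V shrink to a through the cylinders V_k, and let h be a cluster point of these
   involutions s_k. The condition f(V_0) = h(V_0) is open in f, so s_k(V_0) =
   s_k'(V_0) for some k < k'. But s_k(V_0) misses V_k while s_k'(V_0) contains
   V_k \ V_k', which is nonempty because the Cantor set is perfect. *)

Require Import Defs.
From mathcomp Require Import all_boot all_order all_algebra.
From mathcomp Require Import all_classical all_reals all_analysis.

Local Open Scope classical_set_scope.

(** * Cylinders as a clopen base of the Cantor set *)

Definition cylinder (n : nat) (x : cantor_space) : set cantor_space :=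
  [set y | forall i, (i < n)%N -> y i = x i].

Lemma cylinder_sym n x y : cylinder n x y -> cylinder n y x.
Proof. by move=> xy i /xy. Qed.

Lemma cylinder_trans n x y z :
  cylinder n x y -> cylinder n y z -> cylinder n x z.
Proof. by move=> xy yz i ltin; rewrite yz// xy. Qed.

Lemma cylinder_sub m n x : (m <= n)%N -> cylinder n x `<=` cylinder m x.
Proof. by move=> mn y xy i im; apply: xy; exact: leq_trans im mn. Qed.

Lemma nbhs_coord (i : nat) (x : cantor_space) :
  \forall y \near x, y i = x i.
Proof.
have xi : nbhs (x i) [set b | b = x i].
  by rewrite nbhs_principalE; exact/principal_filterP.
exact: (@proj_continuous nat (fun=> bool) i x _ xi).
Qed.

Lemma nbhs_cylinder n x : nbhs x (cylinder n x).
Proof.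
elim: n => [|n IHn]; first by apply: filterS filterT => y _ i.
apply: filterS2 IHn (nbhs_coord n x) => y xy xny i.
by rewrite ltnS leq_eqVlt => /predU1P[->//|/xy].
Qed.

(** The product topology is the supremum of the topologies induced by the coordinates, so the filter
    generated by the cylinders at [x] converges to [x] once it does so in each coordinate; depth
    [i.+1] pins down coordinate [i]. *)
Lemma nbhs_cantorP (x : cantor_space) (A : set cantor_space) :
  nbhs x A <-> exists n, cylinder n x `<=` A.
Proof.
split=> [|[n]]; last by move/filterS; apply; exact: nbhs_cylinder.
pose F : set_system cantor_space :=
  [set B : set cantor_space | exists n, cylinder n x `<=` B].
have FF : Filter F.
  split; first by exists 0%N.
  - move=> P Q [n nP] [m mQ]; exists (maxn n m) => y xy; split.
    + by apply/nP/(cylinder_sub n (maxn n m)) => //; rewrite leq_maxl.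
    + by apply/mQ/(cylinder_sub m (maxn n m)) => //; rewrite leq_maxr.
  - by move=> P Q PQ [n nP]; exists n; exact: subset_trans PQ.
suff Fx : F --> x by exact: Fx.
apply/cvg_sup => i B /= [_ [[C oC <-] Cx CB]].
exists i.+1 => y /(_ _ (ltnSn i)) yx; apply: CB.
by move: Cx; rewrite /proj/= -yx.
Qed.

Lemma open_cylinder n x : open (cylinder n x).
Proof.
rewrite openE => y xy; apply/nbhs_cantorP; exists n => z.
exact: cylinder_trans.
Qed.

Lemma clopen_cylinder n x : clopen (cylinder n x).
Proof.
split; first exact: open_cylinder.
rewrite -openC openE => y /= xy; apply/nbhs_cantorP; exists n => z yz xz.
exact/xy/(cylinder_trans _ _ _ _ xz)/cylinder_sym.
Qed.

(* A form of Lebesgue's number lemma. *)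
Lemma compact_uniform_cylinder (K : set cantor_space)
    (P : nat -> cantor_space -> Prop) :
  compact K ->
  (forall x, K x ->
     exists n, forall m y, (n <= m)%N -> cylinder n x y -> P m y) ->
  exists n, K `<=` P n.
Proof.
move=> /compact_near_coveringP + KP.
have nP x : K x -> \forall y \near x & n \near \oo, P n y.
  move=> /KP[n nP]; exists (cylinder n x, [set m | (n <= m)%N]) => /=.
    by split; [exact: nbhs_cylinder | exists n].
  by move=> [y m] /= [xy nm]; exact: nP.
move=> /(_ _ _ _ _ nP) [n _ nKP]; exists n.
exact: (nKP n (leqnn n)).
Qed.

Lemma cantor_compact (A : set cantor_space) : closed A -> compact A.
Proof.
move=> cA; exact: (subclosed_compact cA cantor_space_compact).
Qed.

Lemma cylinder_partition n : exists (m : nat) (x : 'I_m -> cantor_space),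
  clopen_partition (fun i => cylinder n (x i)).
Proof.
(* Padding a word of length [n] with [false] gives one representative per cylinder. *)
pose x (w : {ffun 'I_n -> bool}) : cantor_space :=
  fun i => if insub i is Some j then w j else false.
exists _, (fun i : 'I_#|{ffun 'I_n -> bool}| => x (enum_val i)); split.
  split.
  - apply/seteqP; split=> // y _; exists (enum_rank [ffun j => y (val j)]) => //.
    move=> i lti; rewrite enum_rankK /x.
    by rewrite (insubT (fun i => i < n)%N lti) ffunE.
  - move=> i j _ _ [y [xiy xjy]]; apply: enum_val_inj; apply/ffunP => k.
    have := xjy k (ltn_ord k); rewrite xiy// /x.
    by rewrite valK => ->.
  - by move=> i _; exists (x (enum_val i)).
by move=> i; exact: clopen_cylinder.
Qed.

(** * The compact-open topology on a group of homeomorphisms *)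

Section HomeoTopology.
Context {X : topologicalType} (G : set (homeo X)).

Definition group_fun (g : set_type G) : X -> X := set_val g : homeo X.

Lemma continuous_homeo (g : homeo X) : continuous g.
Proof. by have [f []] := homeo_funP g. Qed.

Lemma near_image_sub (g : set_type G) (K O : set X) :
  compact K -> open O -> group_fun g @` K `<=` O ->
  \forall h \near g, group_fun h @` K `<=` O.
Proof.
move=> cK oO gKO; pose A := [set f : {compact-open, X -> X} | f @` K `<=` O].
have oA : open A by exact: compact_open_open.
apply: open_nbhs_nbhs; split; last exact: gKO.
by exists (set_val @^-1` A) => //; exists A.
Qed.

End HomeoTopology.

(** The filter [F] of maps that keep every point in its depth-[n] cylinder converges to the
    identity: when a compact [K] lies in an open [O], one depth works for all points of [K] at
    once. *)
Lemma nbhs_one_cylinder (G : set (homeo cantor_space)) (e : set_type G)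
    (A : set (set_type G)) :
  group_fun G e =1 id -> nbhs e A ->
  exists n, forall g, (forall x, cylinder n x (group_fun G g x)) -> A g.
Proof.
move=> e1 [_ [[_ [B oB <-] <-]] Be BA].
pose F : set_system {compact-open, cantor_space -> cantor_space} :=
  [set C | exists n, forall f, (forall x, cylinder n x (f x)) -> C f].
have FF : Filter F.
  split; first by exists 0%N.
  - move=> P Q [n nP] [m mQ]; exists (maxn n m) => f xf; split.
    + by apply: nP => x; apply: cylinder_sub (xf x); rewrite leq_maxl.
    + by apply: mQ => x; apply: cylinder_sub (xf x); rewrite leq_maxr.
  - by move=> P Q PQ [n nP]; exists n => f /nP/PQ.
have FB : F B.
  have : F --> (group_fun G e : {compact-open, cantor_space -> cantor_space}).
    apply/compact_open_cvgP => K O cK oO eKO.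
    have [x Kx|n nO] := @compact_uniform_cylinder K
      (fun n x => cylinder n x `<=` O) cK.
      have /nbhs_cantorP[n nO] : nbhs x O.
        by apply: open_nbhs_nbhs; split=> //; apply: eKO; exists x.
      exists n => m y nm xy z yz; apply: nO.
      exact: cylinder_trans xy (cylinder_sub _ _ _ nm _ yz).
    by exists n => f nf _ [x Kx <-]; exact: nO (nf x).
  by apply; exact: open_nbhs_nbhs.
by case: FB => n nB; exists n => g /nB/BA.
Qed.

(** * Constructing elements of a piecewise full group *)

(** By compactness the local agreements hold on all cylinders of one depth, and these form a finite
    clopen partition. *)
Lemma piecewise_full_group_local (G : set (homeo cantor_space))
    (h : homeo cantor_space) :
  (forall x : cantor_space, exists2 g, G g & \forall y \near x, h y = g y) ->
  piecewise_full_group G h.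
Proof.
move=> hG.
have [x _|n hn] := @compact_uniform_cylinder setT (fun n x =>
    exists2 g, G g & forall y, cylinder n x y -> h y = g y)
    cantor_space_compact.
  have [g Gg /nbhs_cantorP[n nhg]] := hG x.
  exists n => m y nm xy; exists g => // z yz; apply: nhg.
  exact: cylinder_trans xy (cylinder_sub _ _ _ nm _ yz).
have [m [c cP]] := cylinder_partition n.
have /choice[g gP] : forall i, exists g,
    G g /\ forall y, cylinder n (c i) y -> h y = g y.
  by move=> i; have [//|g] := hn (c i); exists g.
by exists m, (fun i => cylinder n (c i)), g; split=> // i; case: (gP i).
Qed.

Section Subgroup.
Context {X : topologicalType} (G : set (homeo X)).
Hypothesis subgroupG : is_subgroup G.

Lemma is_subgroup1 : G 1%g.
Proof. by case: subgroupG => /set_mem. Qed.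

Lemma is_subgroupV g : G g -> G g^-1%g.
Proof. by move=> /mem_set Gg; apply/set_mem/(group_closedV subgroupG). Qed.

Lemma is_subgroupM g h : G g -> G h -> G (g * h)%g.
Proof.
by move=> /mem_set Gg /mem_set Gh; apply/set_mem/(group_closedM subgroupG).
Qed.

End Subgroup.

Lemma homeoK {X : topologicalType} (g : homeo X) : cancel g (g^-1%g : homeo X).
Proof. by move=> x; rewrite -[LHS]/(((g^-1 * g)%g : homeo X) x) mulVg. Qed.

Lemma homeoVK {X : topologicalType} (g : homeo X) : cancel (g^-1%g : homeo X) g.
Proof. by move=> x; rewrite -[LHS]/(((g * g^-1)%g : homeo X) x) mulgV. Qed.

Lemma piecewise_full_swap (G : set (homeo cantor_space))
    (g : homeo cantor_space) (V : set cantor_space) :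
  is_subgroup G -> piecewise_full G -> G g -> clopen V ->
  (forall x, V x -> ~ V (g x)) ->
  exists s, [/\ G s, forall x, V x -> s x = g x, forall x, V x -> s (g x) = x
    & forall x, ~ V x -> (forall y, V y -> g y <> x) -> s x = x].
Proof.
move=> sG fG Gg [oV cV] Vg; pose g' : homeo cantor_space := g^-1%g.
have gK : cancel g g' := homeoK g.
have g'K : cancel g' g := homeoVK g.
(* The test [g' x \in V] says that [x] lies in the image of [V] under [g], which is disjoint from
   [V]. *)
pose s x := if x \in V then g x else if g' x \in V then g' x else x.
have sV x : V x -> s x = g x by rewrite /s => /mem_set ->.
have sgV x : V (g' x) -> s x = g' x.
  move=> Vx; rewrite /s memNset ?mem_set// => /=.
  by rewrite -[x in V x](g'K); exact: Vg.
have sN x : ~ V x -> ~ V (g' x) -> s x = x.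
  by move=> Vx gVx; rewrite /s !memNset.
have sK : involutive s.
  move=> x; have [Vx|nVx] := pselect (V x).
    by rewrite (sV x)// sgV gK.
  have [gVx|ngVx] := pselect (V (g' x)); last by rewrite !sN.
  by rewrite (sgV x)// sV// g'K.
have oVC : open (~` V) by rewrite openC.
have openg : forall A, open A -> open (g' @^-1` A).
  by apply/continuousP => x; exact: continuous_homeo.
have local (x : cantor_space) : exists2 h, G h & \forall y \near x, s y = h y.
  have [Vx|nVx] := pselect (V x).
    by exists g => //; apply: (filterS sV); exact: open_nbhs_nbhs.
  have [gVx|ngVx] := pselect (V (g' x)).
    exists g'; first exact: is_subgroupV.
    by apply: (filterS sgV); apply: open_nbhs_nbhs; split=> //; exact: openg.
  exists (1%g : homeo cantor_space); first exact: is_subgroup1.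
  apply: (@filterS2 _ _ _ (~` V) (g' @^-1` (~` V)) _ sN).
    exact: open_nbhs_nbhs.
  by apply: open_nbhs_nbhs; split=> //; exact: openg.
have cs : continuous s.
  move=> x A sxA; have [h _ sh] := local x.
  move: sxA; rewrite (nbhs_singleton sh) => /(continuous_homeo h x) hA.
  by apply: filterS2 sh hA => y /= ->.
(* An involution is its own inverse, so its continuity suffices. *)
have hs : homeomorphism s by exists s.
exists (mk_homeo hs); split=> //.
- by rewrite -fG; exact: piecewise_full_group_local.
- by move=> x Vx; rewrite -[LHS]/(s (g x)) sgV gK.
- move=> x nVx gx; apply: sN => // /gx; rewrite g'K; exact.
Qed.

(** * Local compactness, uniform discreteness and discreteness *)

Lemma locally_compact_uniformly_discrete (G : set (homeo cantor_space)) :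
  is_subgroup G -> piecewise_full G ->
  locally_compact [set: set_type G] -> uniformly_discrete G.
Proof.
move=> sG fG.
pose e : set_type G := exist _ (1%g : homeo cantor_space)
  (mem_set (is_subgroup1 G sG)).
move=> /(_ e I) [K]; rewrite withinET => Ke [cK _].
have [n nK] := nbhs_one_cylinder G e K (fun=> erefl) Ke.
have [p [c cP]] := cylinder_partition n.
exists p, (fun i => cylinder n (c i)); split=> // x i.
move=> a b [[ga Gga gax] cia] [[gb Ggb gbx] cib].
have ab : cylinder n a b by exact: cylinder_trans (cylinder_sym _ _ _ cia) cib.
pose g : homeo cantor_space := (gb * ga^-1)%g.
have Gg : G g by apply: is_subgroupM => //; exact: is_subgroupV.
have gab : g a = b.
  by rewrite -[LHS]/(gb ((ga^-1%g : homeo cantor_space) a)) -gax homeoK.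
apply: contrapT => a_neq_b.
have [m a_m_b] : exists m, a m <> b m.
  by apply/existsNP => /funext.
(* Depth at least [n] keeps the swaps inside cylinders of depth [n]; depth beyond [m] separates [a]
   from [b]. *)
pose m' := maxn n m.+1.
have [k0 k0a] : exists k0, cylinder k0 a `<=`
    [set y | cylinder m' a y /\ cylinder m' b (g y)].
  apply/nbhs_cantorP; apply: filterI; first exact: nbhs_cylinder.
  by apply: (continuous_homeo g a); rewrite gab; exact: nbhs_cylinder.
pose V k := cylinder (k0 + k) a.
have V0 k : V k `<=` V 0%N by apply: cylinder_sub; rewrite addn0 leq_addr.
have Vm y : V 0%N y -> cylinder m' a y /\ cylinder m' b (g y).
  by rewrite /V addn0; exact: k0a.
have V0g y : V 0%N y -> ~ V 0%N (g y).
  move=> /Vm[_ bgy] /Vm[agy _]; apply: a_m_b.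
  by rewrite -bgy ?agy// leq_max ltnSn orbT.
have /choice[s sP] : forall k, exists s : set_type G,
    [/\ forall x, V k x -> group_fun G s x = g x,
        forall x, V k x -> group_fun G s (g x) = x
      & forall x, ~ V k x -> (forall y, V k y -> g y <> x) ->
          group_fun G s x = x].
  move=> k.
  have [y /V0/V0g + /V0//|s [Gs s1 s2 s3]] := piecewise_full_swap G g (V k)
    sG fG Gg (clopen_cylinder _ _).
  by exists (exist _ s (mem_set Gs)).
(* Both [z] and [g z] lie in the depth-[n] cylinder of [a], so exchanging them preserves every
   cylinder of that depth. *)
have sK k : K (s k).
  apply: nK => y; have [s1 s2 s3] := sP k.
  have near_gy z : V k z -> cylinder n z (g z).
    move=> /V0/Vm[az bgz].
    have /cylinder_sub nm' : (n <= m')%N by exact: leq_maxl.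
    apply: (cylinder_trans _ _ a); first exact/cylinder_sym/nm'.
    by apply: cylinder_trans ab _; exact: nm'.
  have [Vy|nVy] := pselect (V k y); first by rewrite s1//; exact: near_gy.
  have [[z Vz <-]|nz] := pselect (exists2 z, V k z & g z = y).
    by rewrite s2//; exact/cylinder_sym/near_gy.
  by rewrite s3// => z Vz gzy; apply: nz; exists z.
have sA k A : (forall j, (k <= j)%N -> A (s j)) -> (s @ \oo) A.
  by move=> As; exists k.
have [h [_ clh]] := cK (s @ \oo) _ (sA 0%N _ (fun j _ => sK j)).
have [h' [hK h'K ch ch']] := homeo_funP (set_val h : homeo cantor_space).
pose D := h' @^-1` V 0%N.
have [oV cV] : clopen (V 0%N) by exact: clopen_cylinder.
have near_h A : clopen A ->
    \forall f \near h, group_fun G f @` A `<=` h' @^-1` A.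
  move=> [oA cA]; apply: near_image_sub.
  - exact: cantor_compact.
  - by move: A oA {cA}; apply/continuousP.
  - by move=> _ [y Ay <-]; rewrite /preimage/= hK.
(* The set [D] is the image of [V 0] under [h]. As [f] is bijective, the two inclusions together say
   that [f] maps [V 0] onto [D]; each is an open condition because [V 0] and its complement are both
   compact and open. *)
have nbhsN : \forall f \near h, group_fun G f @` V 0%N `<=` D /\
    group_fun G f @` (~` V 0%N) `<=` h' @^-1` (~` V 0%N).
  apply: filterI; apply: near_h => //.
  by split; [exact: closed_openC|exact: open_closedC].
(* A cluster point meets every tail of the sequence, so [k] is chosen first and then some [k']
   beyond it. *)
have [_ [[k _ <-] [_ Nk2]]] := 
  clh (range s) _ (sA 0%N _ (fun j _ => imageP s I)) nbhsN.
have [_ [[k' /= kk' <-] [Nk'1 _]]] := clh [set s j | j in [set j | (k < j)%N]]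
  _ (sA k.+1 _ (fun j kj => imageP s kj)) nbhsN.
(* Coordinate [k0 + k] is the first one that [V k] leaves free, and [V k'] fixes it because
   [k < k']; flipping it in [a] gives a point of [V k] outside [V k']. *)
pose z : cantor_space := fun i => if i == (k0 + k)%N then ~~ a i else a i.
have Vkz : V k z by move=> j; rewrite /z; case: eqP => // ->; rewrite ltnn.
have nVk'z : ~ V k' z.
  move=> /(_ (k0 + k)%N); rewrite /z eqxx ltn_add2l kk' => /(_ isT).
  by case: (a _).
have [_ sk _] := sP k.
have [_ _ sk'] := sP k'.
(* The map [s k] brings [g z], which is outside [V 0], to [z], whereas [s k'] fixes [z], which is in
   [V 0]; so [z] is both outside and inside [D]. *)
have : ~ D z by apply: Nk2; exists (g z); [exact/V0g/V0/Vkz|exact: sk].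
apply; apply: Nk'1; exists z; first exact: V0 Vkz.
by apply: sk' => // y /V0/V0g + gyz; rewrite gyz => /(_ (V0 _ _ Vkz)).
Qed.

(** The [h] that send each preimage of [U i] under [g] into [U i] form a neighbourhood of [g]. For
    such an [h], the points [h x] and [g x] share both an orbit and a piece, hence coincide. *)
Lemma uniformly_discrete_discrete (X : topologicalType) (G : set (homeo X)) :
  compact [set: X] -> uniformly_discrete G -> discrete_space (set_type G).
Proof.
move=> cX [n [U [[[covU _ _] clU] orbU]]].
apply/funext => g; apply/seteqP; split=> A.
  by move=> /nbhs_singleton Ag; exact/principal_filterP.
move=> /principal_filterP Ag.
have near_g i : \forall h \near g,
    group_fun G h @` (group_fun G g @^-1` U i) `<=` U i.
  have [oU cU] := clU i.
  apply: near_image_sub => //; last by move=> _ [x Ux <-].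
  apply: (subclosed_compact _ cX) => //.
  by move: (U i) cU; apply/continuous_closedP => x; exact: continuous_homeo.
apply: filterS (filter_forall _ near_g) => h hU; suff -> : h = g by [].
apply: val_inj; apply: homeo_eqP => x.
have : [set: X] (group_fun G g x) by [].
rewrite -covU => -[i _ Ugx].
by apply: (orbU x i); split=> //;
  [exists (set_val h) => //; exact: set_valP
  |apply: hU; exists x
  |exists (set_val g) => //; exact: set_valP].
Qed.

Lemma discrete_locally_compact (T : topologicalType) :
  discrete_space T -> locally_compact [set: T].
Proof.
move=> dT x _; exists [set x].
  by rewrite withinET dT; exact/principal_filterP.
split; first exact: compact_set1.
by rewrite -openC openE => y /= yx; rewrite /interior dT; exact/principal_filterP.
Qed.

Theorem corollary2p5 (G : set (homeo cantor_space))
  (subgroupG : is_subgroup G) (fullG : piecewise_full G) :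
  [<-> locally_compact [set: set_type G];
       uniformly_discrete G;
       discrete_space (set_type G)].
Proof.
tfae.
- exact: locally_compact_uniformly_discrete.
- exact: uniformly_discrete_discrete cantor_space_compact.
- exact: discrete_locally_compact.
Qed.
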